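(* Let $N\ge 1$, let $\Omega\subseteq\mathbb{R}^N$ be a nonempty (possibly unbounded) open set and let $p\in(2,2^* )$. Let $\mu>0$, assume that $u\in\mathcal{M}_\mu$ is an energy ground state of mass $\mu$, and let $\lambda\in\mathbb{R}$ be the Lagrange multiplier associated with $u$, i.e. the real number such that $u$ is a weak solution of $\Delta u+|u|^{p-2}u=\lambda u$ in $\Omega$. Then $u$ is also an action ground state on $\mathcal{N}_\lambda$. Moreover, any other action ground state $v\in\mathcal{N}_\lambda$ belongs to $\mathcal{M}_\mu$ (i.e. $v$ has the same mass as $u$), and $v$ is also an energy ground state on $\mathcal{M}_\mu$.
   Context: Here $2^*=\frac{2N}{N-2}$ if $N\ge3$ and $2^*=+\infty$ if $N=1,2$; $\|\cdot\|_q$ is the norm of $L^q(\Omega)$; functions are real-valued. For $\lambda\in\mathbb{R}$ and $u\in H_0^1(\Omega)$, the action functional is $J_\lambda(u)=\frac12\|\nabla u\|_2^2+\frac\lambda2\|u\|_2^2-\frac1p\|u\|_p^p$ and the energy functional is $E(u)=\frac12\|\nabla u\|_2^2-\frac1p\|u\|_p^p$. The Nehari manifold is $\mathcal{N}_\lambda=\{u\in H_0^1(\Omega)\setminus\{0\}:\ \|\nabla u\|_2^2+\lambda\|u\|_2^2=\|u\|_p^p\}$. The mass-constrained space is $\mathcal{M}_\mu=\{u\in H_0^1(\Omega):\ \frac12\|u\|_2^2=\mu\}$. The levels are $\mathcal{J}(\lambda)=\inf_{v\in\mathcal{N}_\lambda}J_\lambda(v)$ and $\mathcal{E}(\mu)=\inf_{v\in\mathcal{M}_\mu}E(v)$.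 A function $u\in\mathcal{N}_\lambda$ is an action ground state (on $\mathcal{N}_\lambda$) if $J_\lambda(u)=\mathcal{J}(\lambda)$; a function $u\in\mathcal{M}_\mu$ is an energy ground state (on $\mathcal{M}_\mu$, of mass $\mu$) if $E(u)=\mathcal{E}(\mu)$. Weak solution with $u\in H^1_0(\Omega)$ means $\int_\Omega\nabla u\cdot\nabla w\,dx+\lambda\int_\Omega uw\,dx=\int_\Omega|u|^{p-2}uw\,dx$ for all $w\in H_0^1(\Omega)$. *)

(* Defs.v *)
From HB Require Import structures.
From mathcomp Require Import all_boot all_order all_algebra.
From mathcomp Require Import all_classical all_reals all_analysis.

Set Implicit Arguments.
Unset Strict Implicit.
Unset Printing Implicit Defensive.

Import Order.TTheory GRing.Theory Num.Theory.
Import numFieldNormedType.Exports.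

Local Open Scope classical_set_scope.
Local Open Scope ring_scope.

(* R^N is 'rV[R]_N, which has no measurable structure in the library; it is given
   its Borel sigma-algebra. *)
Section borel_rV.
Context (R : realType) (N : nat).

HB.instance Definition _ :=
  @isMeasurable.Build (sigma_display (@open 'rV[R]_N)) 'rV[R]_N
    <<s @open 'rV[R]_N >> (@sigma_algebra0 _ setT (@open 'rV[R]_N))
    (@sigma_algebraC _ (@open 'rV[R]_N))
    (@sigma_algebra_bigcup _ setT (@open 'rV[R]_N)).

Lemma open_measurable_rV (U : set 'rV[R]_N) : open U -> measurable U.
Proof. by move=> oU; exact: sub_sigma_algebra. Qed.

Lemma continuous_measurable_fun_rV (f : 'rV[R]_N -> R) :
  continuous f -> measurable_fun [set: 'rV[R]_N] f.
Proof.
move=> /continuousP cf; apply: (measurability _ (measurable_realfun.RGenOpens.measurableE R)).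
move=> _ [_ [a [b ->] <-]]; rewrite setTI.
by apply: open_measurable_rV; apply: cf; exact: interval_open.
Qed.

Lemma measurable_coord (i : 'I_N) :
  measurable_fun [set: 'rV[R]_N] (fun v : 'rV[R]_N => v ord0 i).
Proof. by apply: continuous_measurable_fun_rV; exact: coord_continuous. Qed.

Let box (q : 'rV[rat]_N * 'rV[rat]_N) : set 'rV[R]_N :=
  [set x | forall i,
    ball (ratr (q.1 ord0 i) : R) (ratr (q.2 ord0 i)) (x ord0 i)].

Let open_bigcup_box (U : set 'rV[R]_N) : open U ->
  U = \bigcup_(q in [set q | box q `<=` U]) box q.
Proof.
move=> oU; apply/seteqP; split=> [x Ux|x [q /= qU]]; last exact: qU.
have /nbhs_ballP[/= r r0 xrU] : nbhs x U by exact: open_nbhs_nbhs.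
have /choice[cr Hcr] : forall i : 'I_N, exists cr : rat * rat,
    ball (ratr cr.1 : R) (ratr cr.2) (x ord0 i) /\
    ball (ratr cr.1 : R) (ratr cr.2) `<=` ball (x ord0 i) r.
  move=> i; have [||c [s [/set_mem xB BS]]] :=
    @open_subball_rat R (ball (x ord0 i) r) (x ord0 i).
  - exact: ball_open.
  - by apply/mem_set; exact: ballxx.
  - by exists (c, s).
exists (\row_i (cr i).1, \row_i (cr i).2); last first.
  by move=> i /=; rewrite !mxE; have [] := Hcr i.
move=> y yB; apply: xrU; split => // i j; rewrite ord1.
by have [_] := Hcr j; apply; have := yB j; rewrite /= !mxE.
Qed.

Lemma measurable_fun_rV d (T : measurableType d) (f : T -> 'rV[R]_N) :
  (forall i, measurable_fun [set: T] (fun t => f t ord0 i)) ->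
  measurable_fun [set: T] f.
Proof.
move=> mf; apply: (measurability (@open 'rV[R]_N)) => //.
move=> _ [U oU <-]; rewrite setTI (open_bigcup_box oU) preimage_bigcup.
rewrite bigcup_mkcond; apply: countable_bigcupT_measurable => // q.
case: ifPn => // _.
rewrite (_ : _ @^-1` _ = \bigcap_(i in [set: 'I_N]) (fun t => f t ord0 i) @^-1`
    ball (ratr (q.1 ord0 i) : R) (ratr (q.2 ord0 i))); last first.
  by apply/seteqP; split=> t /= h i; [move=> _; exact: h|exact: (h i I)].
apply: fin_bigcap_measurable; first exact: finite_finset.
move=> i _; rewrite -[X in measurable X]setTI.
by apply: mf => //; apply: measurable_realfun.open_measurable; exact: ball_open.
Qed.

End borel_rV.

Section lebesgue_rV.
Local Open Scope ereal_scope.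
Context (R : realType).

Definition cons_rV N (z : measurableTypeR R * 'rV[R]_N) : 'rV[R]_N.+1 :=
  row_mx (z.1)%:M z.2.

Definition uncons_rV N (v : 'rV[R]_N.+1) : measurableTypeR R * 'rV[R]_N :=
  (v ord0 ord0, \row_i v ord0 (lift ord0 i)).

Lemma cons_rV0 N z : @cons_rV N z ord0 ord0 = z.1.
Proof.
transitivity ((z.1)%:M ord0 (ord0 : 'I_1)); last by rewrite mxE eqxx mulr1n.
rewrite -(row_mxEl (z.1)%:M z.2 ord0 ord0).
by congr (row_mx _ _ _ _); exact/val_inj.
Qed.

Lemma cons_rVS N z i : @cons_rV N z ord0 (lift ord0 i) = z.2 ord0 i.
Proof.
rewrite -(row_mxEr (z.1)%:M z.2 ord0 i).
by congr (row_mx _ _ _ _); exact/val_inj.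
Qed.

Lemma cons_rVK N : cancel (@cons_rV N) (@uncons_rV N).
Proof.
move=> z; rewrite /uncons_rV cons_rV0 [RHS]surjective_pairing; congr pair.
by apply/rowP => i; rewrite mxE cons_rVS.
Qed.

Lemma uncons_rVK N : cancel (@uncons_rV N) (@cons_rV N).
Proof.
move=> v; apply/rowP => i; have [->|i0] := eqVneq i ord0.
  by rewrite cons_rV0.
rewrite eq_sym in i0; have [j -> _] := unlift_some i0; by rewrite cons_rVS mxE.
Qed.

Lemma measurable_cons_rV N : measurable_fun [set: _] (@cons_rV N).
Proof.
apply: measurable_fun_rV => i; have [->|i0] := eqVneq i ord0.
  rewrite (_ : (fun t => _) = fst); first exact: measurable_fst.
  by apply/funext => z; rewrite cons_rV0.
rewrite eq_sym in i0; have [j -> _] := unlift_some i0.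
rewrite (_ : (fun t => _) = (fun v : 'rV[R]_N => v ord0 j) \o snd).
  by apply: measurableT_comp; [exact: measurable_coord|exact: measurable_snd].
by apply/funext => z; rewrite cons_rVS.
Qed.

Lemma measurable_uncons_rV N : measurable_fun [set: _] (@uncons_rV N).
Proof.
apply/measurable_fun_pairP; split; first exact: measurable_coord.
apply: measurable_fun_rV => i.
rewrite (_ : (fun t => _) = (fun v : 'rV[R]_N.+1 => v ord0 (lift ord0 i))).
  exact: measurable_coord.
by apply/funext => v; rewrite /= mxE.
Qed.

Section step.
Context (N : nat) (m : {sigma_finite_measure set 'rV[R]_N -> \bar R}).

Definition lebesgue_rV_step : set 'rV[R]_N.+1 -> \bar R :=
  pushforward (@lebesgue_measure R \x m) (@cons_rV N).

Let mcons : measurable_fun [set: _] (@cons_rV N).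
Proof. exact: measurable_cons_rV. Qed.

Let step0 : lebesgue_rV_step set0 = 0.
Proof. exact: measure0. Qed.

Let step_ge0 A : 0 <= lebesgue_rV_step A.
Proof. exact: measure_ge0. Qed.

Let step_sigma_additive : semi_sigma_additive lebesgue_rV_step.
Proof. exact: measure_semi_sigma_additive. Qed.

HB.instance Definition _ := isMeasure.Build _ _ _ lebesgue_rV_step
  step0 step_ge0 step_sigma_additive.

Let step_sigma_finite : sigma_finite [set: 'rV[R]_N.+1] lebesgue_rV_step.
Proof.
have /sigma_finiteP[F [FT ndF Foo]] := sigma_finiteT (@lebesgue_measure R).
have /sigma_finiteP[G [GT ndG Goo]] := sigma_finiteT m.
exists (fun k => @uncons_rV N @^-1` (F k `*` G k)).
  rewrite -preimage_bigcup; apply/esym/seteqP; split=> // v _.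
  have [i _ Fi] : (\bigcup_i F i) (v ord0 ord0) by rewrite -FT.
  have [j _ Gj] : (\bigcup_i G i) (uncons_rV v).2 by rewrite -GT.
  exists (maxn i j) => //; split => /=.
    by move: Fi; exact/subsetPset/ndF/leq_maxl.
  by move: Gj; exact/subsetPset/ndG/leq_maxr.
move=> k; have [? ?] := Foo k; have [? ?] := Goo k; split.
  rewrite -[X in measurable X]setTI; apply: measurable_uncons_rV => //.
  exact: measurableX.
rewrite /lebesgue_rV_step /pushforward -comp_preimage.
rewrite (_ : _ \o _ = id); last by apply/funext => z /=; rewrite cons_rVK.
by rewrite preimage_id product_measure1E// lte_mul_pinfty// ge0_fin_numE.
Qed.

HB.instance Definition _ := Measure_isSigmaFinite.Build _ _ _ lebesgue_rV_step
  step_sigma_finite.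

End step.

(* lambda^0 is the unit mass on the one-point space R^0, and lambda^(N+1) is the
   image of lambda (x) lambda^N under (x, v) |-> (x, v_0, ..., v_(N-1)). *)
Fixpoint lebesgue_rV N : {sigma_finite_measure set 'rV[R]_N -> \bar R} :=
  match N with
  | 0 => [the {sigma_finite_measure set _ -> \bar R} of \d_(0%R : 'rV[R]_0)]
  | N'.+1 => [the {sigma_finite_measure set _ -> \bar R} of
                lebesgue_rV_step (lebesgue_rV N')]
  end.

Lemma lebesgue_rV_setX N (A : 'I_N -> set (measurableTypeR R)) :
  (forall i, measurable (A i)) ->
  lebesgue_rV N [set x | forall i, A i (x ord0 i)] =
  \prod_(i < N) lebesgue_measure (A i).
Proof.
elim: N A => [|N IH] A mA.
  by rewrite big_ord0 /= diracE mem_set// => -[].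
rewrite big_ord_recl -IH//= /lebesgue_rV_step /pushforward -product_measure1E//.
  congr (_ _); apply/seteqP; split=> z /=.
    by move=> Az; split=> [|i]; rewrite -(cons_rV0, cons_rVS).
  move=> [A0 AS] i; have [->|i0] := eqVneq i ord0; first by rewrite cons_rV0.
  rewrite eq_sym in i0; have [j -> _] := unlift_some i0; rewrite cons_rVS.
  exact: AS.
suff -> : (fun v : 'rV[R]_N => forall i, A (lift ord0 i) (v ord0 i)) =
    \bigcap_(i in [set: 'I_N])
      (fun v : 'rV[R]_N => v ord0 i) @^-1` A (lift ord0 i).
  apply: fin_bigcap_measurable; first exact: finite_finset.
  move=> i _; rewrite -[X in measurable X]setTI; apply: measurable_coord => //.
  exact: mA.
apply/seteqP; split=> v h; first by move=> i _; exact: h.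
by move=> i; exact: (h i I).
Qed.

End lebesgue_rV.

(* Functions on Omega are represented by total functions on R^N; only their
   restriction to Omega matters, and functions that agree almost everywhere on
   Omega represent the same element of a Lebesgue or Sobolev space. *)
Section sobolev.
Context (R : realType) (N : nat).
Implicit Types (Omega : set 'rV[R]_N) (f u v w phi : 'rV[R]_N -> R)
  (g : 'rV[R]_N -> 'rV[R]_N).

Definition partial (i : 'I_N) f : 'rV[R]_N -> R := 'D_(delta_mx ord0 i) f.

Definition smooth f := forall s : seq 'I_N,
  let h := foldr partial f s in
  continuous h /\ forall i x, derivable h x (delta_mx ord0 i).

Definition test_function Omega phi :=
  let supp := closure [set x | phi x != 0] in
  [/\ smooth phi, compact supp & supp `<=` Omega].

Definition Lq_norm Omega (q : R) u : \bar R :=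
  ('N[lebesgue_rV R N]_(q%:E)[EFin \o (u \_ Omega)])%E.

Definition L2 Omega u := u \_ Omega \in Lfun (lebesgue_rV R N) 2%:E.

Definition weak_gradient Omega u g := forall (i : 'I_N) phi,
  test_function Omega phi ->
  (\int[lebesgue_rV R N]_(x in Omega) (u x * partial i phi x)%:E =
   - \int[lebesgue_rV R N]_(x in Omega) (g x ord0 i * phi x)%:E)%E.

(* u belongs to the closure of the test functions in H^1(Omega), and g is its
   weak gradient *)
Definition H01_gradient Omega u g :=
  [/\ L2 Omega u,
      forall i, L2 Omega (fun x => g x ord0 i),
      weak_gradient Omega u g
    & exists phi : nat -> 'rV[R]_N -> R,
      [/\ forall n, test_function Omega (phi n),
          Lq_norm Omega 2 (fun x => phi n x - u x) @[n --> \oo] --> 0%E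
        & forall i, Lq_norm Omega 2 (fun x => partial i (phi n) x - g x ord0 i)
            @[n --> \oo] --> 0%E]].

Definition H01 Omega : set ('rV[R]_N -> R) :=
  [set u | exists g, H01_gradient Omega u g].

(* The weak gradient of u in H01 Omega; it is unique up to equality almost
   everywhere on Omega, and a representative is chosen. *)
Definition grad Omega u : 'rV[R]_N -> 'rV[R]_N :=
  xget (fun=> 0) (H01_gradient Omega u).

Definition dot (a b : 'rV[R]_N) : R := \sum_i a ord0 i * b ord0 i.

(* The library norm on 'rV[R]_N is the sup norm, hence this definition. *)
Definition euclid (a : 'rV[R]_N) : R := Num.sqrt (dot a a).

Definition grad_norm Omega u : \bar R :=
  Lq_norm Omega 2 (fun x => euclid (grad Omega u x)).

End sobolev.

Section ground_states.
Local Open Scope ereal_scope.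
Context (R : realType) (N : nat) (Omega : set 'rV[R]_N) (p : R).
Implicit Types (u v w : 'rV[R]_N -> R) (lambda mu : R).

(* The functionals are valued in \bar R because the L^p norm is. On H01 Omega
   they are finite for 2 < p < 2^*, by the Sobolev embedding. *)
Definition action_functional lambda u : \bar R :=
  2^-1%:E * grad_norm Omega u `^ 2 + (lambda / 2)%:E * Lq_norm Omega 2 u `^ 2
  - p^-1%:E * Lq_norm Omega p u `^ p.

Definition energy_functional u : \bar R :=
  2^-1%:E * grad_norm Omega u `^ 2 - p^-1%:E * Lq_norm Omega p u `^ p.

Definition nehari lambda : set ('rV[R]_N -> R) :=
  [set u | [/\ H01 Omega u,
      ~ {ae lebesgue_rV R N, forall x, Omega x -> u x = 0%R}
    & grad_norm Omega u `^ 2 + lambda%:E * Lq_norm Omega 2 u `^ 2 =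
      Lq_norm Omega p u `^ p]].

Definition mass_constrained mu : set ('rV[R]_N -> R) :=
  [set u | H01 Omega u /\ 2^-1%:E * Lq_norm Omega 2 u `^ 2 = mu%:E].

Definition action_level lambda : \bar R :=
  ereal_inf (action_functional lambda @` nehari lambda).

Definition energy_level mu : \bar R :=
  ereal_inf (energy_functional @` mass_constrained mu).

Definition action_ground_state lambda u :=
  nehari lambda u /\ action_functional lambda u = action_level lambda.

Definition energy_ground_state mu u :=
  mass_constrained mu u /\ energy_functional u = energy_level mu.

(* u is a weak solution of Delta u + |u|^(p-2) u = lambda u in Omega *)
Definition weak_solution lambda u :=
  H01 Omega u /\ forall w, H01 Omega w ->
    \int[lebesgue_rV R N]_(x in Omega) (dot (grad Omega u x) (grad Omega w x))%:E
    + lambda%:E * \int[lebesgue_rV R N]_(x in Omega) (u x * w x)%:E =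
    \int[lebesgue_rV R N]_(x in Omega) (`|u x| `^ (p - 2) * u x * w x)%:E.

End ground_states.

Definition sobolev_exponent (R : realType) (N : nat) : \bar R :=
  if (N <= 2)%N then +oo%E else ((2 * N)%:R / (N - 2)%:R)%:E.

(* Main.v *)
Require Import Defs.
From mathcomp Require Import all_boot all_order all_algebra.
From mathcomp Require Import all_classical all_reals all_analysis.
From mathcomp Require Import measurable_realfun ring lra.

Set Implicit Arguments.
Unset Strict Implicit.
Unset Printing Implicit Defensive.

Import Order.TTheory GRing.Theory Num.Theory.
Import numFieldNormedType.Exports.

(** For [w] in the mass-constrained set the action and the energy differ by the
    constant [lambda * mu], so minimizing one over that set is minimizing the
    other. Every [v] in the Nehari manifold has a multiple [t v], [t > 0], of mass
    [mu], and along the ray through [v] the action is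
    [(t^2 / 2 - t^p / p) * B] with [B = |v|_p^p > 0], whose strict maximum over
    [t > 0] is at [t = 1] ([powR_fiber_lt]). Hence, writing J and E for the action
    and the energy,
[[
      J(u) = E(u) + lambda mu <= E(t v) + lambda mu = J(t v) <= J(v)
]]
    for all [v] in the Nehari manifold. As [u] itself lies there (test its equation
    against [u]), it is an action ground state. If [v] is another one, equality
    holds throughout; strictness forces [t = 1], so [v] has mass [mu], and then
    [E(v) = J(v) - lambda mu = E(u)].

    All these quantities are finite: the L^p norm of an element of the Nehari
    manifold is, because the Nehari identity equates its [p]-th power with a finite
    quantity, and scaling preserves finiteness.

    The analytic work lies in [|grad (t v)|_2 = t |grad v|_2], because the gradient
    is a representative selected by a choice operator, and nothing relates the
    selections made for [v] and for [t v] pointwise. What has to be shown is that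
    the L^2 norm is the same for all admissible gradients [g], [h] of one function
    ([grad_norm_sqr_eq]). If the test functions [phi_n] approximate [u] in H^1 with
    [partial i phi_n] tending to [g_i], then [partial i phi_n] is again a test
    function, so [g_i] and [h_i] have the same integral against it; in the limit
    the integrals of [g_i g_i] and [h_i g_i] agree ([H01_gradient_cross]).
    Exchanging [g] and [h] gives [|g_i|_2 = |h_i|_2]. *)

Local Open Scope classical_set_scope.
Local Open Scope ring_scope.

(** * The action along a ray *)

(** With [s = ln t], two tangent lines of the exponential at [2 s], evaluated at
    [0] and at [p s], are combined with weights [p - 2] and [2]; the weights make
    the terms linear in [s] cancel. Both inequalities are strict as [s <> 0]. *)
Lemma powR_fiber_lt (R : realType) (p t : R) : 2 < p -> 0 < t -> t != 1 ->
  t ^+ 2 / 2 - t `^ p / p < 2^-1 - p^-1.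
Proof.
move=> p2 t0 t1; have p0 : 0 < p by lra.
have tE : expR (ln t) = t by rewrite lnK// posrE.
have s0 : ln t != 0 by apply: contra_neq t1 => s0; rewrite -tE s0 expR0.
have t2E : t ^+ 2 = expR (2 * ln t) by rewrite mulrC expRM tE powR_mulrn// ltW.
have tpE : t `^ p = expR (2 * ln t) * expR ((p - 2) * ln t).
  by rewrite -expRD -mulrDl subrKC mulrC expRM tE.
have t2N : expR (2 * ln t) * expR (- (2 * ln t)) = 1 by rewrite -expRD subrr expR0.
have e0 : 0 < expR (2 * ln t) by exact: expR_gt0.
have n2 : - (2 * ln t) != 0 by rewrite oppr_eq0 mulf_neq0// pnatr_eq0.
have np : (p - 2) * ln t != 0 by rewrite mulf_neq0// gt_eqF// subr_gt0.
have h2 := expR_gt1Dx n2; have hp := expR_gt1Dx np.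
have pp : p * t ^+ 2 < 2 * t `^ p + (p - 2).
  rewrite t2E tpE.
  have at0 : (p - 2) * expR (2 * ln t) * (1 + - (2 * ln t)) < p - 2.
    rewrite -[ltRHS]mulr1 -[X in _ < _ * X]t2N -mulrA ltr_pM2l ?subr_gt0//.
    by rewrite ltr_pM2l.
  have atp : 2 * expR (2 * ln t) * (1 + (p - 2) * ln t) <
      2 * (expR (2 * ln t) * expR ((p - 2) * ln t)).
    by rewrite -mulrA ltr_pM2l// ltr_pM2l.
  apply: le_lt_trans (ltrD atp at0); rewrite le_eqVlt; apply/orP; left.
  by apply/eqP; ring.
rewrite -subr_gt0.
have -> : 2^-1 - p^-1 - (t ^+ 2 / 2 - t `^ p / p) =
    (2 * t `^ p + (p - 2) - p * t ^+ 2) / (2 * p).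
  by field; rewrite gt_eqF.
by rewrite divr_gt0 ?subr_gt0// mulr_gt0.
Qed.

Lemma powR_fiber_le (R : realType) (p t : R) : 2 < p -> 0 < t ->
  t ^+ 2 / 2 - t `^ p / p <= 2^-1 - p^-1.
Proof.
move=> p2 t0; have [->|/(powR_fiber_lt p2 t0)/ltW//] := eqVneq t 1.
by rewrite expr1n powR1 !div1r.
Qed.

(** * Integrals and norms *)

Section Lebesgue.
Context d (T : measurableType d) (R : realType).
Context (mu : {measure set T -> \bar R}).
Local Open Scope ereal_scope.

Lemma Lfun_measurable q (f : T -> R) : f \in Lfun mu q ->
  measurable_fun [set: T] f.
Proof. by move=> /andP[/[!inE]]. Qed.

Lemma Lfun_fin_num q (f : T -> R) : f \in Lfun mu q ->
  'N[mu]_q[EFin \o f] \is a fin_num.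
Proof. by move=> /andP[_ /[!inE] fq]; rewrite ge0_fin_numE ?Lnorm_ge0. Qed.

(** Homogeneity without finiteness of the norm: the early terms of an approximating
    sequence may be at infinite distance from the limit. *)
Lemma LnormM_nonneg (f : T -> R) (a q : R) : measurable_fun [set: T] f ->
  (0 <= a)%R -> (0 < q)%R ->
  'N[mu]_(q%:E)[EFin \o (fun x => a * f x)%R] =
  a%:E * 'N[mu]_(q%:E)[EFin \o f].
Proof.
move=> mf a0 q0; rewrite unlock /Lnorm.
under eq_integral do rewrite /= normrM powRM// ger0_norm// EFinM.
rewrite ge0_integralZl_EFin ?powR_ge0//; last first.
  apply/measurable_EFinP; apply: (measurableT_comp (measurable_powR _)) => //.
  exact: measurableT_comp.
rewrite poweRM ?lee_fin ?powR_ge0 ?integral_ge0//.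
by rewrite poweR_EFin -powRrM mulfV ?gt_eqF// powRr1.
Qed.

(** Cauchy-Schwarz, where only the differences [f n - g] are controlled. They are
    in L^2 for large [n], which is enough to split the integral. *)
Lemma cvg_integral_mulr (h g : T -> R) (f : nat -> T -> R) :
  h \in Lfun mu 2%:E -> g \in Lfun mu 2%:E ->
  (forall n, measurable_fun [set: T] (f n)) ->
  'N[mu]_2[EFin \o (fun x => f n x - g x)%R] @[n --> \oo] --> 0 ->
  \int[mu]_x (h x * f n x)%:E @[n --> \oo] --> \int[mu]_x (h x * g x)%:E.
Proof.
move=> h2 g2 mf fg.
have Hoelder n : `|\int[mu]_x (h x * (f n x - g x))%:E| <=
    'N[mu]_2[EFin \o h] * 'N[mu]_2[EFin \o (fun x => f n x - g x)%R].
  have mh := Lfun_measurable h2.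
  have mfg : measurable_fun [set: T] (fun x => f n x - g x)%R.
    by apply: measurable_funB => //; exact: Lfun_measurable g2.
  apply: le_trans (hoelder mu mh mfg _ _ _) => //; last first.
    by rewrite [RHS]splitr !div1r.
  rewrite Lnorm1; apply: le_abse_integral => //.
  by apply/measurable_EFinP; exact: measurable_funM.
have ihg : mu.-integrable setT (EFin \o (h \* g)%R).
  exact/Lfun1_integrable/Lfun2_mul_Lfun1.
have fin_hg : \int[mu]_x (h x * g x)%:E \is a fin_num by exact: integrable_fin_num.
apply/(sube_cvg0 _ fin_hg)/cvg_abse0P.
apply: (@squeeze_cvge _ _ _ _ (cst 0) _
  (fun n => 'N[mu]_2[EFin \o h] * 'N[mu]_2[EFin \o (fun x => f n x - g x)%R])).
- have [fin_fg _] := (fine_cvgP _ _).1 fg.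
  near=> n; rewrite /cst abse_ge0/=; apply: le_trans (Hoelder n).
  have fg2 : (fun x => f n x - g x)%R \in Lfun mu 2%:E.
    rewrite inE; apply/andP; split; rewrite inE/=.
      by apply: measurable_funB => //; exact: Lfun_measurable g2.
    rewrite /finite_norm ltey_eq; apply/orP; left; near: n; exact: fin_fg.
  have ihfg : mu.-integrable setT (EFin \o (h \* (fun x => f n x - g x))%R).
    exact/Lfun1_integrable/Lfun2_mul_Lfun1.
  rewrite -[X in X - _](_ : \int[mu]_x ((h x * (f n x - g x))%:E +
                                        (h x * g x)%:E) = _).
    by rewrite integralD// addeK.
  by apply: eq_integral => x _; rewrite -EFinD -mulrDr subrK.
- exact: cvg_cst.
- rewrite -[X in _ --> X](mule0 ('N[mu]_2[EFin \o h])).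
  by apply: cvgeZl => //; exact: Lfun_fin_num.
Unshelve. all: by end_near. Qed.

End Lebesgue.

(** * Test functions *)

Section SmoothFunctions.
Context (R : realType) (N : nat).
Implicit Types (Omega : set 'rV[R]_N) (phi : 'rV[R]_N -> R) (a : R).

Lemma foldr_partialZ a phi s : smooth phi ->
  foldr (@partial R N) (fun x => a * phi x) s =
  (fun x => a * foldr (@partial R N) phi s x).
Proof.
move=> sphi; elim: s => //= i s ->; apply/funext => x.
by rewrite /partial [LHS]deriveZ//; have [_] := sphi s; apply.
Qed.

Lemma smoothZ a phi : smooth phi -> smooth (fun x => a * phi x).
Proof.
move=> sphi s /=; rewrite foldr_partialZ//; have [cphi dphi] := sphi s.
split=> [x|i x]; last exact: derivableZ.
exact: (continuousZl_tmp (cphi x)).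
Qed.

Lemma smooth_partial i phi : smooth phi -> smooth (partial i phi).
Proof. by move=> sphi s; rewrite -foldr_rcons. Qed.

Lemma smooth_continuous phi : smooth phi -> continuous phi.
Proof. by case/(_ [::]). Qed.

Lemma partialZ a i phi : smooth phi ->
  partial i (fun x => a * phi x) = (fun x => a * partial i phi x).
Proof. exact: (@foldr_partialZ a phi [:: i]). Qed.

Lemma test_function_subsupport Omega phi psi :
  test_function Omega phi -> smooth psi ->
  [set x | psi x != 0] `<=` closure [set x | phi x != 0] ->
  test_function Omega psi.
Proof.
move=> [_ cphi phiO] spsi psiphi.
have sub : closure [set x | psi x != 0] `<=` closure [set x | phi x != 0].
  rewrite [X in _ `<=` X](closure_id _).1; first exact: closureS.
  exact: closed_closure.
split=> //; last exact: subset_trans phiO.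
exact: subclosed_compact (@closed_closure _ _) cphi sub.
Qed.

Lemma test_functionZ Omega a phi :
  test_function Omega phi -> test_function Omega (fun x => a * phi x).
Proof.
move=> tphi; have [sphi _ _] := tphi.
apply: (test_function_subsupport tphi); first exact: smoothZ.
apply: subset_trans (@subset_closure _ _) => x /=.
by apply: contra_neq => ->; rewrite mulr0.
Qed.

Lemma test_function_partial Omega i phi :
  test_function Omega phi -> test_function Omega (partial i phi).
Proof.
move=> tphi; have [sphi _ _] := tphi.
apply: (test_function_subsupport tphi); first exact: smooth_partial.
move=> x /= /eqP; apply: contra_notP => xphi.
suff phi0 : \near x, phi x = cst 0 x.
  by rewrite /partial (near_eq_derive _ phi0) derive_cst.
have : nbhs x (~` closure [set x | phi x != 0]).
  by apply: open_nbhs_nbhs; split => //; exact/closed_openC/closed_closure.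
apply: filterS => y; apply: contra_notP => /eqP phiy.
exact: subset_closure.
Qed.

End SmoothFunctions.

(** * Gradients in H^1_0 *)

Section Sobolev.
Context (R : realType) (N : nat) (Omega : set 'rV[R]_N).
Context (mOmega : measurable Omega).
Implicit Types (u v : 'rV[R]_N -> R) (g h : 'rV[R]_N -> 'rV[R]_N) (a q : R).
Local Notation leb := (lebesgue_rV R N).
Local Open Scope ereal_scope.

Lemma restrictZ a u : (fun x => a * u x)%R \_ Omega =
  (fun x => a * (u \_ Omega) x)%R.
Proof. by apply/funext => x; rewrite !patchE; case: ifP => // _; rewrite mulr0. Qed.

Lemma restrictM u v : (fun x => u x * v x)%R \_ Omega =
  (fun x => (u \_ Omega) x * (v \_ Omega) x)%R.
Proof. by apply/funext => x; rewrite !patchE; case: ifP => // _; rewrite mulr0. Qed.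

Lemma restrictB u v : (fun x => u x - v x)%R \_ Omega =
  (fun x => (u \_ Omega) x - (v \_ Omega) x)%R.
Proof. by apply/funext => x; rewrite !patchE; case: ifP => // _; rewrite subr0. Qed.

Lemma integral_EFin_restrict u :
  \int[leb]_(x in Omega) (u x)%:E = \int[leb]_x ((u \_ Omega) x)%:E.
Proof.
rewrite integral_mkcond; apply: eq_integral => x _.
by rewrite restrict_EFin.
Qed.

Lemma Lq_normZ a q u : measurable_fun [set: _] (u \_ Omega) ->
  (0 <= a)%R -> (0 < q)%R ->
  Lq_norm Omega q (fun x => a * u x)%R = a%:E * Lq_norm Omega q u.
Proof. by move=> mu a0 q0; rewrite /Lq_norm restrictZ LnormM_nonneg. Qed.

Lemma Lq_norm_powE q u : q != 0%R ->
  Lq_norm Omega q u `^ q = \int[leb]_(x in Omega) (`|u x| `^ q)%:E.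
Proof.
move=> q0; rewrite /Lq_norm poweR_Lnorm// integral_EFin_restrict.
apply: eq_integral => x _ /=; rewrite !patchE; case: ifP => //= _.
by rewrite normr0 powR0.
Qed.

Lemma Lq_norm2_sqrE u :
  Lq_norm Omega 2 u `^ 2 = \int[leb]_(x in Omega) (u x * u x)%:E.
Proof.
rewrite Lq_norm_powE//; apply: eq_integral => x _.
by rewrite powR_mulrn// -normrX ger0_norm ?sqr_ge0.
Qed.

Lemma gradP u : H01 Omega u -> H01_gradient Omega u (grad Omega u).
Proof. exact: xgetPex. Qed.

Lemma grad_norm_sqrE u : grad_norm Omega u `^ 2 =
  \int[leb]_(x in Omega) (dot (grad Omega u x) (grad Omega u x))%:E.
Proof.
rewrite /grad_norm Lq_norm2_sqrE; apply: eq_integral => x _.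
rewrite -expr2 sqr_sqrtr// sumr_ge0// => i _.
by rewrite -expr2 sqr_ge0.
Qed.

Lemma L2_fin_num u : L2 Omega u -> Lq_norm Omega 2 u \is a fin_num.
Proof. exact: Lfun_fin_num. Qed.

Lemma L2_sqr_measurable u : L2 Omega u ->
  measurable_fun Omega (fun x => (u x * u x)%:E).
Proof.
move=> u2; apply/measurable_EFinP/measurable_restrictT => //.
by rewrite restrictM; apply: measurable_funM; exact: Lfun_measurable u2.
Qed.

Lemma integral_dotE g : (forall i, L2 Omega (fun x => g x ord0 i)) ->
  \int[leb]_(x in Omega) (dot (g x) (g x))%:E =
  \sum_i \int[leb]_(x in Omega) (g x ord0 i * g x ord0 i)%:E.
Proof.
move=> g2.
rewrite -(@ge0_integral_sum _ _ _ leb _ mOmega _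
  (fun i x => (g x ord0 i * g x ord0 i)%:E))//.
- by apply: eq_integral => x _; rewrite /dot sumEFin.
- by move=> i; exact: L2_sqr_measurable.
- by move=> i x _; rewrite lee_fin -expr2 sqr_ge0.
Qed.

Lemma integral_dot_fin_num g : (forall i, L2 Omega (fun x => g x ord0 i)) ->
  \int[leb]_(x in Omega) (dot (g x) (g x))%:E \is a fin_num.
Proof.
move=> g2; rewrite integral_dotE//; apply/sum_fin_numP => i _ _.
by rewrite -Lq_norm2_sqrE fin_num_poweR// L2_fin_num.
Qed.

Lemma test_function_measurable phi : test_function Omega phi ->
  measurable_fun [set: _] (phi \_ Omega).
Proof.
move=> [sphi _ _]; apply: (measurable_restrictT _ mOmega).1.
apply: measurable_funTS; apply: continuous_measurable_fun_rV.
exact: smooth_continuous.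
Qed.

(** [H01_gradient] provides [phi n] with [partial i (phi n)] tending to the
    [i]-th component of [g] in L^2. Since [partial i (phi n)] is itself a test
    function, integrating it against either gradient gives minus the integral of
    [u] times its own [i]-th derivative; let [n] tend to infinity. *)
Lemma H01_gradient_cross u g h i : H01_gradient Omega u g ->
  H01_gradient Omega u h ->
  \int[leb]_(x in Omega) (g x ord0 i * g x ord0 i)%:E =
  \int[leb]_(x in Omega) (h x ord0 i * g x ord0 i)%:E.
Proof.
move=> [u2 g2 ug [phi [tphi _ cphi]]] [_ h2 uh _].
have cvg_g f : L2 Omega f ->
    \int[leb]_(x in Omega) (f x * partial i (phi n) x)%:E @[n --> \oo] -->
    \int[leb]_(x in Omega) (f x * g x ord0 i)%:E.
  move=> f2; rewrite integral_EFin_restrict restrictM.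
  under eq_cvg do rewrite integral_EFin_restrict restrictM.
  apply: cvg_integral_mulr => //; first exact: g2.
    by move=> n; apply: test_function_measurable; exact: test_function_partial.
  have := cphi i; rewrite /Lq_norm.
  by under eq_cvg do rewrite restrictB.
have eq_gh n : \int[leb]_(x in Omega) (g x ord0 i * partial i (phi n) x)%:E =
    \int[leb]_(x in Omega) (h x ord0 i * partial i (phi n) x)%:E.
  have tn := test_function_partial i (tphi n).
  by apply: oppe_inj; rewrite -ug// -uh.
have cg := cvg_g _ (g2 i); have ch := cvg_g _ (h2 i).
move: cg; under eq_cvg do rewrite eq_gh.
by move=> cg; exact: (cvg_unique _ cg ch).
Qed.

(** Any admissible gradient computes the gradient norm: both cross terms of [g] and
    the selected gradient are the same integral. *)
Lemma grad_norm_sqr_eq u g : H01_gradient Omega u g ->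
  grad_norm Omega u `^ 2 = \int[leb]_(x in Omega) (dot (g x) (g x))%:E.
Proof.
move=> ug; have uG : H01_gradient Omega u (grad Omega u).
  by apply: gradP; exists g.
have [_ g2 _ _] := ug; have [_ G2 _ _] := uG.
rewrite grad_norm_sqrE !integral_dotE//; apply: eq_bigr => i _.
rewrite (H01_gradient_cross i uG ug) (H01_gradient_cross i ug uG).
by apply: eq_integral => x _; rewrite mulrC.
Qed.

Lemma grad_norm_sqr_fin_num u : H01 Omega u ->
  grad_norm Omega u `^ 2 \is a fin_num.
Proof.
by move=> /gradP[_ g2 _ _]; rewrite grad_norm_sqrE integral_dot_fin_num.
Qed.

Lemma L2Z a u : L2 Omega u -> L2 Omega (fun x => a * u x)%R.
Proof.
move=> u2; rewrite /L2 restrictZ.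
rewrite (_ : (fun x => _) = a \o* (u \_ Omega)); last first.
  by apply/funext => x /=; rewrite mulrC.
by apply: Lfun_scale => //; lra.
Qed.

(** The weak gradient identity for [a u] against [psi] is the one for [u] against the
    test function [a psi], so [a] is never pulled out of an integral that might
    diverge. *)
Lemma H01_gradientZ a u g : (0 <= a)%R -> H01_gradient Omega u g ->
  H01_gradient Omega (fun x => a * u x)%R (fun x => a *: g x).
Proof.
move=> a0 [u2 g2 ug [phi [tphi phiu phig]]].
have entryE i : (fun x => (a *: g x) ord0 i) = (fun x => a * g x ord0 i)%R.
  by apply/funext => x; rewrite mxE.
have cvgZ (f : nat -> 'rV[R]_N -> R) k : L2 Omega k ->
    (forall n, test_function Omega (f n)) ->
    Lq_norm Omega 2 (fun x => f n x - k x)%R @[n --> \oo] --> 0 ->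
    Lq_norm Omega 2 (fun x => a * f n x - a * k x)%R @[n --> \oo] --> 0.
  move=> k2 tf fk.
  have mfk n : measurable_fun [set: _] ((fun x => f n x - k x)%R \_ Omega).
    rewrite restrictB; apply: measurable_funB; last exact: Lfun_measurable k2.
    exact: test_function_measurable.
  rewrite (_ : (fun n => _) = (fun n => a%:E *
      Lq_norm Omega 2 (fun x => f n x - k x)%R)); last first.
    apply/funext => n; rewrite -Lq_normZ//.
    by under eq_fun do rewrite -mulrBr.
  by rewrite -[X in _ --> X](mule0 a%:E); exact: cvgeZl.
split.
- exact: L2Z.
- by move=> i; rewrite entryE; exact: L2Z.
- move=> i psi tpsi; have [spsi _ _] := tpsi.
  have := ug i _ (test_functionZ a tpsi); rewrite partialZ// => ugpsi.
  under eq_integral do rewrite mulrAC mulrC.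
  under [X in - X]eq_integral do rewrite mxE mulrAC mulrC.
  exact: ugpsi.
- exists (fun n x => a * phi n x)%R; split.
  + by move=> n; exact: test_functionZ.
  + exact: cvgZ.
  + move=> i.
    rewrite (_ : (fun n => _) = (fun n => Lq_norm Omega 2
        (fun x => a * partial i (phi n) x - a * g x ord0 i)%R)).
      by apply: cvgZ => // n; exact: test_function_partial.
    apply/funext => n; congr Lq_norm; apply/funext => x.
    by have [sphi _ _] := tphi n; rewrite partialZ// mxE.
Qed.

End Sobolev.

(** * Action and energy on the Nehari manifold *)

Section Functionals.
Context (R : realType) (N : nat) (Omega : set 'rV[R]_N) (p : R).
Context (mOmega : measurable Omega) (p_gt2 : 2 < p).
Implicit Types (u v : 'rV[R]_N -> R) (lambda mu t : R).
Local Notation leb := (lebesgue_rV R N).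
Local Open Scope ereal_scope.

Let p_gt0 : (0 < p)%R. Proof. exact: lt_trans p_gt2. Qed.

Lemma Lq_norm_eq0_ae q u : (0 < q)%R -> measurable_fun [set: _] (u \_ Omega) ->
  Lq_norm Omega q u = 0 -> {ae leb, forall x, Omega x -> u x = 0%R}.
Proof.
move=> q0 mu u0.
have : (EFin \o (u \_ Omega)) = \0 %[ae leb].
  by apply: (@Lnorm_eq0_eq0 _ _ _ _ _ q%:E) => //; exact/measurable_EFinP.
apply: filterS => x /= ux Ox; have := ux I.
by rewrite patchE mem_set// => -[].
Qed.

Lemma ae0_Lq_norm2 u : L2 Omega u ->
  {ae leb, forall x, Omega x -> u x = 0%R} -> Lq_norm Omega 2 u `^ 2 = 0.
Proof.
move=> u2 u0; rewrite Lq_norm2_sqrE.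
rewrite (@ae_eq_integral _ _ _ _ _ (cst 0)) ?integral0//.
  exact: L2_sqr_measurable.
by apply: filterS u0 => x u0 /u0 /= ->; rewrite mulr0.
Qed.

Lemma weak_solution_nehari lambda u : weak_solution Omega p lambda u ->
  ~ {ae leb, forall x, Omega x -> u x = 0%R} -> nehari Omega p lambda u.
Proof.
move=> [uH /(_ u uH) usol] u0; split=> //.
rewrite grad_norm_sqrE Lq_norm2_sqrE usol Lq_norm_powE ?gt_eqF//.
apply: eq_integral => x _; congr EFin.
have [->|ux0] := eqVneq (u x) 0%R; first by rewrite mulr0 normr0 powR0 ?gt_eqF.
rewrite -mulrA -expr2 -real_normK ?num_real// -powR_mulrn// -powRD ?subrK//.
by rewrite gt_eqF.
Qed.

(** Here [G], [M], [B] are the squared gradient norm, the squared L^2 norm and the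
    [p]-th power of the L^p norm of [v]. [B] is finite since the Nehari identity
    writes it as [G + lambda M]; this is what makes every functional along the ray
    of [v] a real number. *)
Lemma nehari_fiber lambda v : nehari Omega p lambda v ->
  exists G M B : R, [/\ (0 < M)%R, (0 < B)%R, (G + lambda * M = B)%R &
    forall t, (0 < t)%R -> let tv := (fun x => t * v x)%R in
    [/\ H01 Omega tv, grad_norm Omega tv `^ 2 = (t ^+ 2 * G)%:E,
        Lq_norm Omega 2 tv `^ 2 = (t ^+ 2 * M)%:E &
        Lq_norm Omega p tv `^ p = (t `^ p * B)%:E]].
Proof.
move=> [vH v0 nv].
have [v2 g2 _ _] := gradP vH.
have mv : measurable_fun [set: _] (v \_ Omega) by exact: Lfun_measurable v2.
have norm_pow_gt0 q : (0 < q)%R -> 0 < Lq_norm Omega q v `^ q.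
  move=> q0; rewrite lt0e poweR_ge0 andbT; apply/eqP => /poweR_eq0_eq0.
  by move=> /(_ (Lnorm_ge0 _ _ _)) /(Lq_norm_eq0_ae q0 mv).
have M0 := norm_pow_gt0 2%R (ltr0Sn _ 1); have B0 := norm_pow_gt0 p p_gt0.
have finM : Lq_norm Omega 2 v `^ 2 \is a fin_num.
  by rewrite fin_num_poweR// L2_fin_num.
have finG := grad_norm_sqr_fin_num mOmega vH.
have finB : Lq_norm Omega p v `^ p \is a fin_num.
  by rewrite -nv fin_numD finG fin_numM.
exists (fine (grad_norm Omega v `^ 2)), (fine (Lq_norm Omega 2 v `^ 2)),
  (fine (Lq_norm Omega p v `^ p)); split.
- by rewrite -lte_fin fineK.
- by rewrite -lte_fin fineK.
- by rewrite -[RHS](congr1 fine nv) fineD ?fineM ?fin_numM.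
move=> t t0; have t0' := ltW t0.
have tvH := H01_gradientZ mOmega t0' (gradP vH).
split; rewrite ?EFinM ?fineK//.
- by eexists; exact: tvH.
- rewrite (grad_norm_sqr_eq mOmega tvH) grad_norm_sqrE.
  rewrite -ge0_integralZl_EFin ?sqr_ge0//.
  + apply: eq_integral => x _; rewrite -EFinM; congr EFin.
    by rewrite /dot mulr_sumr; apply: eq_bigr => i _; rewrite !mxE; ring.
  + by move=> x _; rewrite lee_fin sumr_ge0// => i _; rewrite -expr2 sqr_ge0.
  + apply/measurable_EFinP/measurable_sum => i.
    by apply/measurable_EFinP; exact: (L2_sqr_measurable mOmega (g2 i)).
- by rewrite Lq_normZ// poweRM ?Lnorm_ge0// poweR_EFin powR_mulrn.
- by rewrite Lq_normZ// poweRM ?Lnorm_ge0// poweR_EFin.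
Qed.

Lemma nehari_mass_action lambda mu v :
  nehari Omega p lambda v -> mass_constrained Omega mu v ->
  exists2 e : R, energy_functional Omega p v = e%:E &
    action_functional Omega p lambda v = (e + lambda * mu)%:E.
Proof.
move=> /nehari_fiber[G [M [B [M0 B0 _ /(_ 1%R ltr01)]]]].
rewrite (_ : (fun x => 1 * v x)%R = v); last by apply/funext => x; rewrite mul1r.
rewrite expr1n powR1 !mul1r => -[_ EG EM EB] [_].
rewrite /energy_functional /action_functional EG EM EB -EFinM => -[massv].
exists (2^-1 * G - p^-1 * B)%R => //.
by rewrite -!EFinM -!EFinD -massv; congr EFin; ring.
Qed.

(** The fiber inequality, read on the multiple of [v] that has mass [mu]: its action,
    which is its energy [e] plus [lambda * mu], is at most the action of [v]. *)
Lemma nehari_rescale lambda mu v : (0 < mu)%R -> nehari Omega p lambda v ->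
  exists t e A : R, let tv := (fun x => t * v x)%R in
    [/\ mass_constrained Omega mu tv, energy_functional Omega p tv = e%:E,
        action_functional Omega p lambda v = A%:E, (e + lambda * mu <= A)%R &
        t != 1%R -> (e + lambda * mu < A)%R].
Proof.
move=> mu0 /nehari_fiber[G [M [B [M0 B0 GMB vt]]]].
have muM0 : (0 < 2 * mu / M)%R by rewrite divr_gt0// mulr_gt0.
pose t := Num.sqrt (2 * mu / M); have t0 : (0 < t)%R by rewrite sqrtr_gt0.
have tM : (t ^+ 2 * M = 2 * mu)%R by rewrite sqr_sqrtr ?ltW// divfK// gt_eqF.
have [tvH tG tM2 tB] := vt t t0.
have := vt 1%R ltr01.
rewrite (_ : (fun x => 1 * v x)%R = v); last by apply/funext => x; rewrite mul1r.
rewrite expr1n powR1 !mul1r => -[_ EG EM EB].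
pose e := (2^-1 * (t ^+ 2 * G) - p^-1 * (t `^ p * B))%R.
have eE : (e + lambda * mu = (t ^+ 2 / 2 - t `^ p / p) * B)%R.
  (* the mass of t v is mu, so lambda * mu completes G to G + lambda M = B *)
  rewrite /e -GMB (_ : mu = t ^+ 2 * M / 2)%R; last by rewrite tM; field.
  by ring.
exists t, e, ((2^-1 - p^-1) * B)%R; split.
- by split=> //; rewrite tM2 tM -EFinM mulKf.
- by rewrite /energy_functional tG tB.
- rewrite /action_functional EG EM EB -!EFinM -!EFinD -GMB; congr EFin.
  by field; rewrite gt_eqF.
- by rewrite eE ler_pM2r// powR_fiber_le.
- by move=> t1; rewrite eE ltr_pM2r// powR_fiber_lt.
Qed.

Lemma mass_constrained_neq0 mu u : (0 < mu)%R -> mass_constrained Omega mu u ->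
  ~ {ae leb, forall x, Omega x -> u x = 0%R}.
Proof.
move=> mu0 [[g [u2 _ _ _]] + /(ae0_Lq_norm2 u2) u0].
by rewrite u0 mule0 => -[mu_eq0]; rewrite -mu_eq0 ltxx in mu0.
Qed.

End Functionals.

Theorem theorem1p3 (R : realType) (N : nat) (Omega : set 'rV[R]_N)
    (p mu lambda : R) (u : 'rV[R]_N -> R)
    (N_ge1 : (1 <= N)%N) (Omega_neq0 : Omega !=set0) (Omega_open : open Omega)
    (p_gt2 : 2 < p) (p_lt : (p%:E < sobolev_exponent R N)%E)
    (mu_gt0 : 0 < mu)
    (u_energy : energy_ground_state Omega p mu u)
    (u_sol : weak_solution Omega p lambda u) :
  action_ground_state Omega p lambda u /\
  forall v : 'rV[R]_N -> R, action_ground_state Omega p lambda v ->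
    mass_constrained Omega mu v /\ energy_ground_state Omega p mu v.
Proof.
have mOmega := open_measurable_rV Omega_open.
have [u_mass u_min] := u_energy.
have u_nehari : nehari Omega p lambda u.
  apply: weak_solution_nehari => //.
  exact: (mass_constrained_neq0 mOmega mu_gt0 u_mass).
have [e eE actE] := nehari_mass_action mOmega p_gt2 u_nehari u_mass.
have e_le w f : mass_constrained Omega mu w ->
    energy_functional Omega p w = f%:E -> e <= f.
  by move=> wM wE; rewrite -lee_fin -eE -wE u_min; apply: ereal_inf_lbound; exists w.
have u_action : action_ground_state Omega p lambda u.
  split=> //; apply/eqP; rewrite eq_le; apply/andP; split; last first.
    by apply: ereal_inf_lbound; exists u.
  apply: le_ereal_inf_tmp => _ [v vN <-].
  have [t [f [A [tvM tvE vE fA _]]]] := nehari_rescale mOmega p_gt2 mu_gt0 vN.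
  rewrite vE actE lee_fin; apply: le_trans fA.
  by rewrite lerD2r (e_le _ _ tvM).
split=> // v [vN v_min].
have [t [f [A [tvM tvE vE _ fA]]]] := nehari_rescale mOmega p_gt2 mu_gt0 vN.
have AE : A = e + lambda * mu.
  by apply: EFin_inj; rewrite -vE v_min -actE; case: u_action.
have t1 : t = 1.
  apply/eqP; apply: contraT => /fA; rewrite AE ltrD2r.
  by rewrite ltNge (e_le _ _ tvM).
have v_mass : mass_constrained Omega mu v.
  by move: tvM; rewrite t1; under eq_fun do rewrite mul1r.
split=> //; split=> //.
have [k kE vkE] := nehari_mass_action mOmega p_gt2 vN v_mass.
rewrite -u_min kE eE; congr EFin; apply: (addIr (lambda * mu)).
by apply: EFin_inj; rewrite -vkE vE AE.
Qed.
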